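(* Let $k\geq 5$ be a natural number. If $$n \geq \frac{2}{\ln 2} k^2 + \left(2 - \frac{3}{\ln 2}\right) k + \frac{1}{\ln 2} \geq \frac{2^{\frac{1}{k-1}}(2k)-1}{2^{\frac{1}{k-1}}-1},$$ then $$t(K(n,k)) = \frac{n}{k} -1.$$ Moreover, any subset of vertices $S$ such that $t(K(n,k))=\frac{|S|}{c(K(n,k)\setminus S)}$ must be the complement of a maximum independent set in $K(n,k)$.
   Context: For integers $n\geq 2k+1$, the Kneser graph $K(n,k)$ has as vertices the $k$-element subsets of $[n]=\{1,\dots,n\}$, two vertices $A,B$ being adjacent iff $A\cap B=\emptyset$. For a connected graph $G$, a vertex cut is a set $S$ of vertices whose removal disconnects $G$; $c(G\setminus S)$ denotes the number of connected components of the graph obtained by deleting $S$. The toughness of $G$ is $t(G)=\min_S \frac{|S|}{c(G\setminus S)}$, the minimum over all vertex cuts $S$ of $G$.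
   Formalization: In the ''Moreover'' part, S is required to be a vertex cut; for arbitrary subsets the claim fails (k=5, n=65: any 12 vertices leave a connected graph, with ratio 12 = n/k−1, but are not the complement of a maximum independent set). *)

(* Defs.v *)
From HB Require Import structures.
From mathcomp Require Import all_boot all_order all_algebra.
From mathcomp Require Import all_classical all_reals all_analysis.
Set Implicit Arguments. Unset Strict Implicit. Unset Printing Implicit Defensive.
Import Order.TTheory GRing.Theory Num.Theory.

Definition kvert (n k : nat) := {A : {set 'I_n} | #|A| == k}.

Definition kneser_adj (n k : nat) : rel (kvert n k) :=
  fun A B => [disjoint (val A) & (val B)].

Arguments kneser_adj : clear implicits.

Section Graphs.
Variable T : finType.
Variable adj : rel T.

Definition del_adj (S : {set T}) : rel T :=
  fun x y => [&& x \notin S, y \notin S & adj x y].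

Definition components (S : {set T}) : {set {set T}} :=
  [set [set y | connect (del_adj S) x y] | x in ~: S].

Definition ncomp (S : {set T}) : nat := #|components S|.

Definition is_vertex_cut (S : {set T}) : bool := 1 < ncomp S.

Definition tough_ratio (R : realType) (S : {set T}) : R :=
  (#|S|%:R / (ncomp S)%:R)%R.

Definition is_toughness (R : realType) (t : R) : Prop :=
  (exists S, is_vertex_cut S /\ tough_ratio R S = t) /\
  (forall S, is_vertex_cut S -> (t <= tough_ratio R S)%R).

Definition independent (I : {set T}) : bool :=
  [forall x in I, forall y in I, ~~ adj x y].

Definition max_independent (I : {set T}) : bool :=
  independent I && [forall J : {set T}, independent J ==> (#|J| <= #|I|)].

End Graphs.

(* Main.v *)
(* Let S be a cut, U its complement, I the set of isolated vertices of U and b the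
   number of the other components, so that c <= |I| + b. Every vertex of I meets every
   vertex of U. On a cyclic order of the ground set with i > 0 arcs of length k in I
   and u in U one has i <= k and u <= 2k - i, so k u + (n - k) i <= k n; averaging gives
   k |U| + (n - k) |I| <= k C(n,k), which contains the Erdos-Ko-Rado bound
   (take I = U) and settles the case b = 0 together with its equality case.
   Let b > 0 and al = C(n-1,k-1). If 5 c <= al, the common neighbours of two vertices in
   different components already make S too large. Otherwise a failure of the bound
   makes the averaged inequality tight up to (n - k) b, where b <= C(2k,k) by Bollobas'
   inequality is far smaller than al. Then most cycles meeting I carry exactly k
   arcs of I, all through one point, and re-randomising such a cycle outside one of
   these arcs and its predecessor gives a point y of large degree in I. Every vertex
   of U then contains y, so U spans no edge, contradicting b > 0. *)
Require Import Defs.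
From HB Require Import structures.
From mathcomp Require Import all_boot all_order all_algebra all_fingroup zify ring lra.
Set Implicit Arguments. Unset Strict Implicit. Unset Printing Implicit Defensive.

(** * Cyclic distance and arcs on n positions *)

Definition cdist (n p q : nat) := if p <= q then q - p else q + n - p.

Definition arc (n l : nat) (p : 'I_n) : {set 'I_n} := [set q : 'I_n | cdist n p q < l].

Definition rotate (n : nat) (p : 'I_n) (j : nat) : 'I_n :=
  Ordinal (ltn_pmod (p + j) (leq_ltn_trans (leq0n p) (ltn_ord p))).

Lemma rotateE n (p : 'I_n) j : j < n ->
  rotate p j = (if p + j < n then p + j else p + j - n) :> nat.
Proof.
move=> jn; have pn := ltn_ord p; rewrite /=; case: ifP => h; first by rewrite modn_small.
have -> : p + j = (p + j - n) + n by lia.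
rewrite modnDr modn_small; lia.
Qed.

Lemma cdist_rotate n (p : 'I_n) j : j < n -> cdist n p (rotate p j) = j.
Proof. by move=> jn; rewrite rotateE // /cdist; have := ltn_ord p; repeat case: ifP; lia. Qed.

Lemma rotate_cdist n (p q : 'I_n) : rotate p (cdist n p q) = q.
Proof.
have := ltn_ord p; have := ltn_ord q => qn pn.
have cn : cdist n p q < n by rewrite /cdist; case: ifP; lia.
by apply: ord_inj; rewrite !rotateE // /cdist; repeat case: ifP; lia.
Qed.

Lemma card_arc n l (p : 'I_n) : l <= n -> #|arc l p| = l.
Proof.
move=> ln; have -> : arc l p = [set rotate p j | j : 'I_l].
  apply/setP=> q; rewrite inE; apply/idP/imsetP => [ql|[j _ ->]].
    by exists (Ordinal ql); rewrite //= rotate_cdist.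
  by rewrite cdist_rotate //; apply: leq_trans ln.
rewrite card_imset ?card_ord // => i j ij; apply/val_inj => /=.
have h (x : 'I_l) : x < n by apply: leq_trans ln.
by rewrite -(cdist_rotate p (h i)) ij cdist_rotate.
Qed.

Lemma cdist_lt n (p q : 'I_n) : cdist n p q < n.
Proof. by have := ltn_ord p; have := ltn_ord q; rewrite /cdist; case: ifP; lia. Qed.

(** Reading every position by its distance from one base point [z] turns claims about the cycle into
    linear arithmetic on naturals. *)
Lemma cdist_rebase n (z p q : 'I_n) :
  cdist n p q = cdist n (cdist n z p) (cdist n z q).
Proof.
have := ltn_ord z; have := ltn_ord p; have := ltn_ord q; rewrite /cdist.
move: (z : nat) (p : nat) (q : nat) => a b c *.
by case: (leqP a b) => ?; case: (leqP a c) => ?; case: (leqP b c) => ?; case: ifP => ?; lia.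
Qed.

Lemma cdist_inj n (z p q : 'I_n) : cdist n z p = cdist n z q -> p = q.
Proof. by move=> pq; rewrite -(rotate_cdist z p) pq rotate_cdist. Qed.

Lemma cdist_rotate_rebase n (z p : 'I_n) j : j < n ->
  cdist n z (rotate p j) =
    if cdist n z p + j < n then cdist n z p + j else cdist n z p + j - n.
Proof.
move=> jn; have := cdist_rotate p jn; rewrite (cdist_rebase z).
have := cdist_lt z (rotate p j); have := cdist_lt z p.
move: (cdist n z (rotate p j)) (cdist n z p) => a b; rewrite /cdist.
by case: ifP => ?; case: ifP => ?; lia.
Qed.

(** * Cross-intersecting arcs on a single cycle *)

Section Cycle.
Variables (n k : nat) (P Q : {set 'I_n}).
Hypotheses (k0 : 0 < k) (kn : 3 * k <= n) (sPQ : P \subset Q).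
Hypothesis PQ : forall p q, p \in P -> q \in Q -> (cdist n p q < k) || (cdist n q p < k).

(* Positions just before a maximal run of P; the run is short when it has fewer
   than k elements, since P lies in a window of k consecutive positions. *)
Definition runs := [set t | (t \notin P) && (rotate t 1 \in P)].
Definition short_runs := [set t in runs | rotate t k \notin P].

(** Since [3 * k <= n], elements of [P] pairwise closer than [k] cannot go round the cycle. The
    element [p0] farthest behind a fixed [p] is therefore the first one, and [p1] is the last. *)
Lemma window : P != set0 -> exists p0 p1, [/\ p0 \in P, p1 \in P,
  cdist n p0 p1 < k & forall p, p \in P -> cdist n p0 p <= cdist n p0 p1].
Proof.
case/set0Pn=> p pP.
have PP x y (xP : x \in P) (yP : y \in P) := PQ xP (subsetP sPQ _ yP).
have pp : cdist n p p < k by rewrite /cdist leqnn subnn.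
pose L := [pred q in P | cdist n q p < k].
have Lp : L p by rewrite /= pP.
case: (arg_maxnP (fun q : 'I_n => cdist n q p) Lp) => p0 /andP[p0P p0p] p0max.
have p00 : cdist n p0 p0 = 0 by rewrite /cdist leqnn subnn.
have p0k x : x \in P -> cdist n p0 x < k.
  move=> xP; have := PP _ _ p0P xP; have := PP _ _ pP xP; have := p0max x.
  rewrite /= xP /= !(cdist_rebase p0 x) !(cdist_rebase p0 p) p00; move: p0p.
  have := cdist_lt p0 x; have := cdist_lt p0 p.
  move: (cdist n p0 p) (cdist n p0 x) => a b; rewrite /cdist.
  by case: (leqP a b) => ?; case: (leqP b a) => ?; case: (leqP b 0) => ?; lia.
case: (arg_maxnP (fun q : 'I_n => cdist n p0 q) pP) => p1 p1P p1max.
by exists p0, p1; split=> //; apply: p0k.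
Qed.

(** One run is enough: a nonempty [P] fits in an arc of length [k], and the position before its
    first element is in [runs]. *)
Lemma card_runs : #|P| <= k * #|runs|.
Proof.
have [->|/window[p0 [p1 [p0P p1P p01 p0max]]]] := eqVneq P set0; first by rewrite cards0.
have Parc : P \subset arc k p0.
  by apply/subsetP=> p pP; rewrite inE; apply: leq_ltn_trans (p0max _ pP) _.
have kn' : k <= n by lia.
apply: leq_trans (subset_leq_card Parc) _; rewrite card_arc // leq_pmulr // card_gt0.
apply/set0Pn; exists (rotate p0 n.-1); rewrite inE; have p0n := ltn_ord p0.
apply/andP; split.
  apply/negP=> /p0max; rewrite cdist_rotate; lia.
suff -> : rotate (rotate p0 n.-1) 1 = p0 by [].
apply: (@cdist_inj _ p0); rewrite cdist_rotate_rebase; last lia.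
by rewrite cdist_rotate; [rewrite /cdist leqnn subnn; case: ifP; lia|lia].
Qed.

(* If P spans e + 1 positions, then Q lies in a window of 2k - 1 - e positions,
   while P and short_runs together fit in a window of k positions. *)
Lemma cycle_ineq :
  k * #|Q| + (n - k) * #|P| + (n - 2 * k) * #|short_runs| <= k * n.
Proof.
have kn' : k <= n by lia.
have [P0|/window[p0 [p1 [p0P p1P p01 p0max]]]] := eqVneq P set0.
  have -> : short_runs = set0 by apply/setP=> t; rewrite !inE P0 !inE andbF.
  rewrite P0 !cards0 !muln0 !addn0 leq_mul2l; apply/orP; right.
  by apply: leq_trans (max_card _) _; rewrite card_ord.
have p00 : cdist n p0 p0 = 0 by rewrite /cdist leqnn subnn.
have [e eE] : exists e, cdist n p0 p1 = e by exists (cdist n p0 p1).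
rewrite eE in p01 p0max.
have cP : #|P| <= e.+1.
  have <- : #|arc e.+1 p0| = e.+1 by rewrite card_arc //; lia.
  by apply/subset_leq_card/subsetP => p pP; rewrite inE ltnS p0max.
have cQ : #|Q| <= 2 * k - e.+1.
  (* The window of [Q] opens [k - 1 - e] positions before [p0], at offset [n - k + e + 1]. For
     [e + 1 = k] this is [n], out of range for [cdist_rotate], hence the value 0. *)
  pose d := if k == e.+1 then 0 else n - k + e.+1.
  have dE : (k = e.+1 /\ d = 0) \/ (k <> e.+1 /\ d = n - k + e.+1).
    by rewrite /d; case: eqVneq => [|/eqP]; [left|right].
  have dn : d < n by lia.
  have <- : #|arc (2 * k - e.+1) (rotate p0 d)| = 2 * k - e.+1 by rewrite card_arc //; lia.
  apply/subset_leq_card/subsetP => q qQ; rewrite inE.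
  have := PQ p0P qQ; have := PQ p1P qQ; have := cdist_lt p0 q.
  rewrite (cdist_rebase p0 p1) !(cdist_rebase p0 q) (cdist_rebase p0 (rotate _ _)).
  rewrite cdist_rotate // p00 eE; move: (cdist n p0 q) => x xn.
  move: (d) dE => d' dE; rewrite /cdist.
  by repeat (case: ifP => ?); lia.
have cS : #|P| + #|short_runs| <= k.
  rewrite -cardsUI; have -> : P :&: short_runs = set0.
    by apply/setP=> t; rewrite !inE; case: (t \in P).
  rewrite cards0 addn0.
  (* If [e + 1 = k], the position before [p0] reaches [p1] after [k] steps, so it is not a short run
     and the window opens at [p0]; otherwise it opens one position earlier. *)
  pose d := if k == e.+1 then 0 else n.-1.
  have dE : (k = e.+1 /\ d = 0) \/ (k <> e.+1 /\ d = n.-1).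
    by rewrite /d; case: eqVneq => [|/eqP]; [left|right].
  have dn : d < n by lia.
  have <- : #|arc k (rotate p0 d)| = k by rewrite card_arc.
  apply/subset_leq_card/subsetP => t.
  rewrite in_setU [in X in _ -> X]inE (cdist_rebase p0 (rotate _ _)) cdist_rotate //.
  move=> /orP[tP|].
    have := p0max _ tP; have := cdist_lt p0 t; move: (cdist n p0 t) => x xn; move: (d) dE => d' dE; rewrite /cdist.
    by repeat (case: ifP => ?); lia.
  rewrite !inE => /andP[/andP[_ t1P] tkP].
  have tk : rotate t k <> p1 by move=> h; rewrite h p1P in tkP.
  have {tk} : cdist n p0 (rotate t k) <> e by rewrite -eE => /cdist_inj.
  have := p0max _ t1P; have := cdist_lt p0 t; rewrite !cdist_rotate_rebase; try lia.
  move: (cdist n p0 t) => x xn; move: (d) dE => d' dE; rewrite /cdist.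
  by repeat (case: ifP => ?); lia.
(* By [cS] the last two terms are at most [(n - 2 * k) * k + k * #|P|], and by [cP] the excess
   [k * #|P|] is at most the [k * (e + 1)] saved in [cQ]. *)
nia.
Qed.

End Cycle.

Import Order.TTheory GRing.Theory Num.Theory.

(** * Bollobas' set-pair inequality *)

Section Bollobas.
Local Open Scope ring_scope.
Variables (T J : finType).

Let w (a b : nat) : rat := ('C(a + b, a)%:R)^-1.

(** With [a = #|A|] and [b = #|B|], the points of [B] contribute [b * w a (b - 1) = (a + b) * w a b]
    in total, and each point of [Y] outside [A] and [B] contributes [w a b]. *)
Lemma bollobas_weight (Y A B : {set T}) :
  A \subset Y -> B \subset Y -> [disjoint A & B] -> (0 < #|B|)%N ->
  \sum_(x in Y | x \notin A) w #|A| #|B :\ x| = #|Y|%:R * w #|A| #|B|.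
Proof.
move=> AY BY dAB B0; rewrite (bigID (fun x => x \in B)) /=.
have e1 : \sum_(x in Y | (x \notin A) && (x \in B)) w #|A| #|B :\ x|
          = #|B|%:R * w #|A| #|B|.-1.
  rewrite (eq_bigl (fun x => x \in B)); last first.
    move=> x; case xB: (x \in B); rewrite ?andbF // andbT (subsetP BY) //=.
    by move: dAB; rewrite disjoint_sym => /disjointFr ->.
  rewrite (eq_bigr (fun _ => w #|A| #|B|.-1)) ?sumr_const ?mulr_natl // => x xB.
  by rewrite (cardsD1 x B) xB.
have e2 : \sum_(x in Y | (x \notin A) && (x \notin B)) w #|A| #|B :\ x|
          = (#|Y| - (#|A| + #|B|))%N%:R * w #|A| #|B|.
  rewrite (eq_bigl (fun x => x \in Y :\: (A :|: B))); last first.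
    by move=> x; rewrite !inE negb_or andbC.
  rewrite (eq_bigr (fun _ => w #|A| #|B|)).
    rewrite sumr_const mulr_natl cardsD (setIidPr _) ?subUset ?AY //.
    by rewrite cardsU disjoint_setI0 // cards0 subn0.
  move=> x; rewrite !inE negb_or => /andP[/andP[_ xB] _].
  by rewrite (cardsD1 x B) (negbTE xB).
under eq_bigl do rewrite -andbA.
rewrite e1; under eq_bigl do rewrite -andbA.
rewrite e2.
have le : (#|A| + #|B| <= #|Y|)%N.
  have := subset_leq_card (_ : A :|: B \subset Y); rewrite subUset AY BY => /(_ isT).
  by rewrite cardsU disjoint_setI0 // cards0 subn0.
rewrite natrB // -[in RHS](subrK (#|A| + #|B|)%N%:R #|Y|%:R) [RHS]mulrDl addrC; congr (_ + _).
rewrite /w; set a := #|A|; move: B0; case: #|B| => // b _ /=.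
have := mul_bin_down (a + b.+1) a; rewrite addnS /= -addnS addKn => h.
have c1 : ('C(a + b, a)%:R : rat) != 0 by rewrite pnatr_eq0 -lt0n bin_gt0 leq_addr.
have c2 : ('C(a + b.+1, a)%:R : rat) != 0 by rewrite pnatr_eq0 -lt0n bin_gt0 leq_addr.
by apply/eqP; rewrite eqr_div // -!natrM -h.
Qed.

(* Induction on Y: delete a point x from the B_i, keeping only the pairs with x
   outside A_i, and average over x; bollobas_weight says that the averaged weights
   reproduce the original ones. *)
Lemma bollobas_sum (A B : J -> {set T}) (Y : {set T}) (D : {set J}) :
  (forall i, i \in D -> [/\ A i \subset Y, B i \subset Y & [disjoint A i & B i]]) ->
  (forall i j, i \in D -> j \in D -> i != j -> ~~ [disjoint A i & B j]) ->
  \sum_(i in D) w #|A i| #|B i| <= 1.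
Proof.
move: {2}#|Y| (leqnn #|Y|) => m; elim: m B Y D => [|m IH] B Y D Ym dAB cAB.
(* An empty [B i] is disjoint from every [A j], so [D] is then a singleton, of weight 1. *)
all: have [/existsP[i /andP[iD /eqP Bi]]|/existsPn B0] :=
  boolP [exists i, (i \in D) && (B i == set0)].
1,3: have Di : D = [set i].
1,3: apply/setP=> j; rewrite inE; apply/idP/eqP=> [jD|->//]; apply/eqP.
1,2: by apply: contraT => /(cAB _ _ jD iD); rewrite Bi -setI_eq0 setI0 eqxx.
1,2: by rewrite Di big_set1 Bi cards0 /w addn0 binn invr1.
all: have {}B0 i : i \in D -> B i != set0 by move=> iD; have := B0 i; rewrite iD.
  rewrite big1 // => i iD; case: (dAB i iD) => _ BY _.
  by have := B0 i iD; rewrite -subset0; move: Ym BY; rewrite leqn0 cards_eq0 => /eqP-> ->.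
have [D0|[i0 i0D]] := set_0Vmem D; first by rewrite D0 big_set0.
have Y0 : (0 < #|Y|)%N.
  case: (dAB _ i0D) => _ BY _; apply: leq_trans (subset_leq_card BY).
  by rewrite card_gt0; apply: B0.
have Y0' : 0 < #|Y|%:R :> rat by rewrite ltr0n.
rewrite -(ler_pM2l Y0') mulr1 mulr_sumr.
rewrite (eq_bigr (fun i => \sum_(x in Y | x \notin A i) w #|A i| #|B i :\ x|)); last first.
  move=> i iD; case: (dAB i iD) => h1 h2 h3.
  by rewrite bollobas_weight // card_gt0; apply: B0.
rewrite (exchange_big_dep (mem Y)) /=; last by move=> i x _ /andP[].
rewrite -[X in _ <= X%:R]sum1_card natr_sum; apply: ler_sum => x xY.
rewrite (eq_bigl (fun i => i \in [set i in D | x \notin A i])); last first.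
  by move=> i; rewrite inE xY.
apply: (IH (fun i => B i :\ x) (Y :\ x)).
- by move: Ym; rewrite (cardsD1 x Y) xY.
- move=> i; rewrite inE => /andP[iD xA]; case: (dAB i iD) => h1 h2 h3; split.
  + by rewrite subsetD1 h1 xA.
  + exact: setSD.
  + by apply: disjointWr h3; apply: subD1set.
- move=> i j; rewrite !inE => /andP[iD xA] /andP[jD _] /(cAB _ _ iD jD).
  apply: contra => /pred0P h; apply/pred0P=> y; have := h y; rewrite /= !inE.
  by case: eqP => [->|//]; rewrite (negbTE xA).
Qed.

Lemma bollobas (A B : J -> {set T}) (D : {set J}) a b :
  (forall i, i \in D -> [/\ #|A i| = a, #|B i| = b & [disjoint A i & B i]]) ->
  (forall i j, i \in D -> j \in D -> i != j -> ~~ [disjoint A i & B j]) ->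
  (#|D| <= 'C(a + b, a))%N.
Proof.
move=> dAB cAB; have := @bollobas_sum A B [set: T] D.
rewrite (eq_bigr (fun _ => w a b)); last by move=> i /dAB[-> ->].
rewrite sumr_const /w => h.
have c0 : 0 < 'C(a + b, a)%:R :> rat by rewrite ltr0n bin_gt0 leq_addr.
rewrite -(ler_nat rat) -[X in _ <= X]mul1r -ler_pdivrMr // mulr_natl; apply: h => // i /dAB[_ _ ?].
by rewrite !subsetT.
Qed.

End Bollobas.

(** * Averaging over permutations *)

Section PermAverage.
Variable T : finType.

(** Composing with the transposition of [p x] and [y] repairs the head and leaves the images of the
    tail in place. *)
Lemma exists_perm_map (s s' : seq T) : uniq s -> uniq s' -> size s = size s' ->
  exists p : {perm T}, map p s = s'.
Proof.
elim: s s' => [|x s IH] [|y s'] //=; first by exists 1%g.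
case/andP=> xs us /andP[ys us'] [ss]; have [p ps] := IH _ us us' ss.
exists (p * tperm (p x) y)%g; rewrite permM tpermL; congr (_ :: _).
rewrite -[RHS]ps; apply/eq_in_map => z zs; rewrite permM tpermD //.
  by rewrite (inj_eq perm_inj); apply: contraNneq xs => ->.
by apply: contraNneq ys => ->; rewrite -ps map_f.
Qed.

Lemma exists_perm_fixing (D A B : {set T}) :
  [disjoint D & A] -> [disjoint D & B] -> #|A| = #|B| ->
  exists p : {perm T}, {in D, forall x, p x = x} /\ p @: A = B.
Proof.
move=> DA DB AB.
have u (F : {set T}) : [disjoint D & F] -> uniq (enum D ++ enum F).
  move=> DF; rewrite cat_uniq !enum_uniq andbT /=; apply/hasPn=> x.
  by rewrite !mem_enum => xF; rewrite (disjointFl DF xF).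
have [|p pE] := exists_perm_map (u _ DA) (u _ DB); first by rewrite !size_cat -!cardE AB.
move: pE; rewrite map_cat => /eqP; rewrite eqseq_cat ?size_map // => /andP[/eqP pD /eqP pA].
exists p; split=> [x xD|].
  have : x \in enum D by rewrite mem_enum.
  by move: pD; rewrite -[in RHS](map_id (enum D)) => /eq_in_map; apply.
by apply/setP=> x; rewrite -[RHS]mem_enum -pA; apply/imsetP/mapP => -[z zA ->];
  exists z; rewrite ?mem_enum // -mem_enum.
Qed.

(** Right multiplication by a permutation taking [A] to [B] embeds the permutations sending [P] to
    [A] into those sending [P] to [B], so all these fibres have one size; the family of all sets of
    size [#|P|] determines it. *)
Lemma card_perm_image (P : {set T}) (F : {set {set T}}) :
  {in F, forall A : {set T}, #|A| = #|P|} ->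
  #|[set s : {perm T} | s @: P \in F]| * 'C(#|T|, #|P|) = #|F| * #|T|`!.
Proof.
pose K (A : {set T}) := #|[set s : {perm T} | s @: P == A]|.
have leK (A B : {set T}) : #|A| = #|P| -> #|B| = #|P| -> K A <= K B.
  move=> cA cB; have [p [_ pAB]] : exists p : {perm T}, {in set0, forall x, p x = x} /\ p @: A = B.
    by apply: exists_perm_fixing; rewrite ?cA // -setI_eq0 set0I.
  rewrite /K -(card_imset _ (@mulIg _ p)); apply/subset_leq_card/subsetP => _ /imsetP[s + ->].
  rewrite !inE => /eqP sP; rewrite -pAB -sP -imset_comp; apply/eqP/eq_imset => x.
  by rewrite /= permM.
have sumK (G : {set {set T}}) : {in G, forall A : {set T}, #|A| = #|P|} ->
    #|[set s : {perm T} | s @: P \in G]| = #|G| * K P.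
  move=> cG; rewrite -sum_nat_const -sum1_card.
  rewrite (partition_big (fun s : {perm T} => s @: P) (mem G)) /=; last by move=> s; rewrite inE.
  apply: eq_bigr => A AG; transitivity (K A); last by apply/eqP; rewrite eqn_leq !leK ?cG.
  rewrite /K -sum1_card; apply: eq_bigl => s; rewrite !inE.
  by case: eqP => [->|]; rewrite ?AG ?andbF.
move=> cF; rewrite sumK //.
have := sumK [set A : {set T} | #|A| == #|P|]; rewrite card_draws => h.
have -> : #|T|`! = 'C(#|T|, #|P|) * K P.
  rewrite -h; last by move=> A; rewrite inE => /eqP.
  have := card_perm [set: T]; rewrite cardsT => <-.
  apply: eq_card => s; rewrite !inE card_imset ?eqxx //; last exact: perm_inj.
  by apply/subsetP=> x _; rewrite inE.
by rewrite -mulnA (mulnC (K P)).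
Qed.

(* Randomising s outside D keeps s in E and makes s @: R uniform among the sets of
   its size that avoid s @: D. *)
Lemma degree_count (D R : {set T}) (x : T) (E : {set {perm T}}) (F : {set {set T}}) M :
  x \in D -> [disjoint D & R] ->
  (forall s p : {perm T}, {in D, forall z, p z = z} -> s \in E -> (p * s)%g \in E) ->
  (forall y, #|[set A in F | y \in A]| <= M) ->
  #|[set s in E | s @: (x |: R) \in F]| * 'C(#|T| - #|D|, #|R|) <= #|E| * M.
Proof.
move=> xD DR Einv FM.
pose G (B : {set T}) := [set s in E | s @: (x |: B) \in F].
pose X := [set B : {set T} | (B \subset ~: D) && (#|B| == #|R|)].
have cX : #|X| = 'C(#|T| - #|D|, #|R|).
  by rewrite /X cards_draws (cardsCs (~: D)) setCK.
have GX B : B \in X -> #|G R| <= #|G B|.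
  rewrite inE => /andP[BD /eqP cB].
  have DB : [disjoint D & B] by rewrite disjoint_sym -[D]setCK -subsets_disjoint.
  have [p [pD pB]] := exists_perm_fixing DB DR cB.
  rewrite -(card_imset _ (@mulgI _ p)); apply/subset_leq_card/subsetP => _ /imsetP[s + ->].
  rewrite !inE => /andP[sE sF]; rewrite Einv //=.
  suff -> : (p * s)%g @: (x |: B) = s @: (x |: R) by [].
  rewrite -pB -{2}(pD x xD) -imsetU1 -imset_comp; apply: eq_imset => z.
  by rewrite /= permM.
apply: leq_trans (_ : \sum_(B in X) #|G B| <= _).
  by rewrite -cX mulnC -sum_nat_const; apply: leq_sum => B /GX.
rewrite -sum_nat_const.
under eq_bigr => B _ do rewrite -sum1_card.
rewrite (exchange_big_dep (mem E)) /=; last by move=> B s _; rewrite inE => /andP[].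
(* For fixed [s] the sets [s @: (x |: B)] are distinct members of [F] through [s x], so at most [M]
   of them occur. *)
apply: leq_sum => s sE; rewrite sum1dep_card; apply: leq_trans (FM (s x)).
have inj : {in [set B | (B \in X) && (s \in G B)] &, injective (fun B : {set T} => s @: (x |: B))}.
  move=> B B'; rewrite !inE => /andP[/andP[BD _] _] /andP[/andP[BD' _] _].
  move/(imset_inj perm_inj) => h.
  have xn (C : {set T}) : C \subset ~: D -> x \notin C.
    by move=> CD; apply/negP => /(subsetP CD); rewrite inE xD.
  by rewrite -(setU1K (xn _ BD)) h setU1K // xn.
rewrite -(card_in_imset inj); apply/subset_leq_card/subsetP => _ /imsetP[B + ->].
by rewrite !inE => /andP[_ /andP[_ ->]] /=; rewrite imset_f // !inE eqxx.
Qed.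

End PermAverage.

(** * Averaged inequality and stability for cross-intersecting families *)

Section CrossIntersecting.
Variables (n k : nat) (I U : {set {set 'I_n}}).
Hypotheses (k0 : 0 < k) (kn : 3 * k <= n) (sIU : I \subset U).
Hypothesis cardU : {in U, forall A : {set 'I_n}, #|A| = k}.
Hypothesis IU : forall A B, A \in I -> B \in U -> ~~ [disjoint A & B].

Let starts (F : {set {set 'I_n}}) (s : {perm 'I_n}) := [set t : 'I_n | s @: arc k t \in F].

Let kn' : k <= n. Proof. lia. Qed.

Lemma arc_meet (p q x : 'I_n) : x \in arc k p -> x \in arc k q ->
  (cdist n p q < k) || (cdist n q p < k).
Proof.
rewrite !inE (cdist_rebase p q x) (cdist_rebase p q p) => xp.
have -> : cdist n p p = 0 by rewrite /cdist leqnn subnn.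
have := cdist_lt p q; move: xp; move: (cdist n p x) (cdist n p q) => a b; rewrite /cdist.
by case: (leqP b a) => ?; case: (leqP b 0) => ?; lia.
Qed.

Lemma starts_cross s p q : p \in starts I s -> q \in starts U s ->
  (cdist n p q < k) || (cdist n q p < k).
Proof.
rewrite !inE => pI qU; have := IU pI qU; rewrite -setI_eq0 => /set0Pn[y].
rewrite inE => /andP[/imsetP[x xp ->] /imsetP[z zq /perm_inj xz]].
by apply: (@arc_meet p q x) => //; rewrite xz.
Qed.

Lemma starts_sub s : starts I s \subset starts U s.
Proof. by apply/subsetP=> t; rewrite !inE => /(subsetP sIU). Qed.

Lemma sum_starts (F : {set {set 'I_n}}) : F \subset U ->
  (\sum_(s : {perm 'I_n}) #|starts F s|) * 'C(n, k) = n * n`! * #|F|.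
Proof.
move=> FU; under eq_bigr do rewrite -sum1_card.
rewrite (exchange_big_dep predT) //= big_distrl /=.
rewrite (eq_bigr (fun _ => #|F| * n`!)) ?sum_nat_const ?card_ord; first by rewrite mulnA mulnAC.
move=> t _; rewrite sum1dep_card.
have := @card_perm_image _ (arc k t) F; rewrite card_arc // card_ord => <-.
  by congr (_ * _); apply: eq_card => s; rewrite !inE.
by move=> A /(subsetP FU)/cardU.
Qed.

Let cyc s := cycle_ineq k0 kn (starts_sub s) (@starts_cross s).

(** Sums [cycle_ineq] over all permutations; the short-run term is kept as the slack exploited in
    [cross_stability]. *)
Lemma cross_slack :
  n * n`! * (k * #|U| + (n - k) * #|I|)
  + (n - 2 * k) * (\sum_(s : {perm 'I_n}) #|short_runs k (starts I s)|) * 'C(n, k)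
  <= n * n`! * (k * 'C(n, k)).
Proof.
have h : \sum_(s : {perm 'I_n}) (k * #|starts U s| + (n - k) * #|starts I s|
     + (n - 2 * k) * #|short_runs k (starts I s)|) <= \sum_(s : {perm 'I_n}) k * n.
  by apply: leq_sum => s _; apply: cyc.
move: h; rewrite !big_split /= -!big_distrr /= sum_nat_const.
have := card_perm [set: 'I_n]; rewrite cardsT card_ord => cS.
have -> : #|{perm 'I_n}| = n`!.
  by rewrite -cS; apply: eq_card => s; rewrite !inE; apply/esym/subsetP=> x _; rewrite inE.
have := sum_starts (subxx U); have := sum_starts sIU.
move: (\sum_(s : {perm 'I_n}) #|starts I s|) (\sum_(s : {perm 'I_n}) #|starts U s|) => a b ha hb.
rewrite -(leq_pmul2r (_ : 0 < 'C(n, k))) ?bin_gt0 // => h.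
rewrite mulnDr !(mulnCA (n * _)) -ha -hb; move: h.
move: (n - k) (n - 2 * k) n`! 'C(n, k) (\sum_s _) => x y f N S h.
apply: leq_trans (leq_trans h _); first by apply: eq_leq; ring.
by apply: eq_leq; ring.
Qed.

Lemma cross_ratio : k * #|U| + (n - k) * #|I| <= k * 'C(n, k).
Proof.
have nf : 0 < n * n`! by rewrite muln_gt0 fact_gt0; lia.
by rewrite -(leq_pmul2l nf); apply: leq_trans (leq_addr _ _) cross_slack.
Qed.

(* When a run of starts of I begins after t and is not short, the last arc of its
   window is in I; that arc meets the positions t, ..., t + k fixing the event only
   in t + k, so degree_count applies with D = arc k.+1 t. *)
Lemma run_degree M : (forall y, #|[set A in I | y \in A]| <= M) ->
  let Er := \sum_(s : {perm 'I_n}) #|runs (starts I s)| in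
  'C(n - k.+1, k.-1) * Er <=
  M * Er + 'C(n - k.+1, k.-1) * \sum_(s : {perm 'I_n}) #|short_runs k (starts I s)|.
Proof.
move=> IM /=.
have sumE (X : {perm 'I_n} -> {set 'I_n}) :
    \sum_(s : {perm 'I_n}) #|X s| = \sum_(t : 'I_n) #|[set s | t \in X s]|.
  under eq_bigr do rewrite -sum1_card; rewrite (exchange_big_dep predT) //=.
  by apply: eq_bigr => t _; rewrite sum1dep_card.
rewrite !sumE !big_distrr -big_split /=; apply: leq_sum => t _.
set E := [set s | t \in runs _].
have tk0 : cdist n t (rotate t k) = k by rewrite cdist_rotate; lia.
have xx (x : 'I_n) : cdist n x x = 0 by rewrite /cdist leqnn subnn.
have cR : #|arc k (rotate t k) :\ rotate t k| = k.-1.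
  by have := cardsD1 (rotate t k) (arc k (rotate t k)); rewrite card_arc // inE xx k0 => /(congr1 predn) ->.
have deg : #|[set s in E | s @: arc k (rotate t k) \in I]| * 'C(n - k.+1, k.-1) <= #|E| * M.
  have := @degree_count _ (arc k.+1 t) (arc k (rotate t k) :\ rotate t k) (rotate t k) E I M.
  rewrite setD1K; last by rewrite inE xx.
  rewrite cR card_arc ?card_ord; last lia.
  apply=> //.
  - by rewrite inE tk0.
  - rewrite -setI_eq0; apply/eqP/setP=> y; rewrite !inE.
    apply/negP=> /andP[ty /andP[yx]]; rewrite (cdist_rebase t (rotate t k)) tk0.
    have : cdist n t y <> k by rewrite -tk0 => /cdist_inj e; rewrite e eqxx in yx.
    have := cdist_lt t y; move: ty; move: (cdist n t y) => a; rewrite /cdist.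
    by case: ifP => ?; lia.
  - move=> s p pD.
    have pa t' : arc k t' \subset arc k.+1 t -> (p * s)%g @: arc k t' = s @: arc k t'.
      by move=> /subsetP sub; apply: eq_in_imset => z /sub zD; rewrite permM pD.
    have t1 : arc k (rotate t 1) \subset arc k.+1 t.
      apply/subsetP => y; rewrite !inE (cdist_rebase t (rotate t 1)) cdist_rotate; last lia.
      have := cdist_lt t y; move: (cdist n t y) => a; rewrite /cdist.
      by case: ifP => ?; lia.
    have t0 : arc k t \subset arc k.+1 t by apply/subsetP=> y; rewrite !inE; lia.
    by rewrite !inE !pa.
(* A run beginning after [t] is short exactly when the arc at [t + k] is not in [I]. *)
have EB : #|E| = #|[set s in E | s @: arc k (rotate t k) \in I]|
                 + #|[set s | t \in short_runs k (starts I s)]|.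
  rewrite -(cardsID [set s : {perm 'I_n} | s @: arc k (rotate t k) \in I] E).
  by congr (_ + _); apply: eq_card => s; rewrite !inE // andbC.
by rewrite {1}EB mulnDr leq_add2r mulnC (mulnC M).
Qed.

(** Three averaged bounds are chained: each cycle has at most [k] arcs of [I] per run, [run_degree]
    forces many runs to be short when [M] is small, and each short run costs [n - 2 * k] in
    [cross_slack]. *)
Lemma cross_stability M : (forall y, #|[set A in I | y \in A]| <= M) ->
  ('C(n - k.+1, k.-1) - M) * #|I| * (n - 2 * k) <=
  k * 'C(n - k.+1, k.-1) * (k * 'C(n, k) - (k * #|U| + (n - k) * #|I|)).
Proof.
move=> /run_degree /=; have := cross_slack; have := sum_starts sIU.
have : \sum_(s : {perm 'I_n}) #|starts I s| <= k * \sum_(s : {perm 'I_n}) #|runs (starts I s)|.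
  rewrite big_distrr; apply: leq_sum => s _.
  exact: card_runs k0 kn (starts_sub s) (@starts_cross s).
have nf : 0 < n * n`! by rewrite muln_gt0 fact_gt0; lia.
have N0 : 0 < 'C(n, k) by rewrite bin_gt0.
move: nf N0; set C := 'C(_ - _, _).
move: (n * n`!) 'C(n, k) (\sum_s _) (\sum_s _) (\sum_s _) => f N B E P f0 N0 PE PI slack deg.
set W := k * #|U| + _ in slack *.
have s2 : (n - 2 * k) * B * N <= f * (k * N - W) by rewrite mulnBr; lia.
have s3 : (C - M) * E <= C * B by rewrite mulnBl; lia.
have s1 : f * #|I| <= k * E * N by rewrite -PI leq_mul2r PE orbT.
rewrite -(leq_pmul2l f0).
have -> : f * ((C - M) * #|I| * (n - 2 * k)) = (C - M) * (n - 2 * k) * (f * #|I|) by ring.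
apply: leq_trans (leq_mul (leqnn _) s1) _.
have -> : (C - M) * (n - 2 * k) * (k * E * N) = (n - 2 * k) * k * N * ((C - M) * E) by ring.
apply: leq_trans (leq_mul (leqnn _) s3) _.
have -> : (n - 2 * k) * k * N * (C * B) = k * C * ((n - 2 * k) * B * N) by ring.
have -> : f * (k * C * (k * N - W)) = k * C * (f * (k * N - W)) by ring.
by rewrite leq_mul.
Qed.

End CrossIntersecting.

(** * Binomial estimates *)

(** Pascal's rule is applied [d] times, each use losing at most ['C(m.-1, j)]. *)
Lemma bin_le_drop m d j : d <= m -> 'C(m, j.+1) <= 'C(m - d, j.+1) + d * 'C(m.-1, j).
Proof.
elim: d => [|d IH] dm; first by rewrite subn0 leq_addr.
apply: leq_trans (IH (ltnW dm)) _; have -> : m - d = (m - d.+1).+1 by lia.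
rewrite binS mulSn addnA leq_add2r leq_add2l; apply: leq_bin2l; lia.
Qed.

(** The factors compare one by one: [p - i >= c * (q - i)]. *)
Lemma bin_ge_expn c p q j : 0 < c -> c * q <= p -> c ^ j * 'C(q, j) <= 'C(p, j).
Proof.
move=> c0 qp; elim: j => [|j IH]; first by rewrite !bin0.
rewrite -(leq_pmul2l (ltn0Sn j)) mulnCA !mul_bin_left expnS.
have -> : c * c ^ j * ((q - j) * 'C(q, j)) = (c * (q - j)) * (c ^ j * 'C(q, j)) by ring.
by apply: leq_mul IH; nia.
Qed.

Lemma expn6_gt k : 5 <= k -> 50 * k + 10 < 6 ^ k.-1.
Proof.
case: k => [|[|[|[|[|m]]]]] //= _.
by elim: m => [//|m IH]; rewrite expnS; lia.
Qed.

Section Bounds.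
Variables n k : nat.
(** [nk] is the quadratic hypothesis of the theorem with [1 / ln 2] lowered to 4/3 and denominators
    cleared. *)
Hypotheses (k5 : 5 <= k) (nk : 8 * k ^ 2 + 4 <= 3 * n + 6 * k).

Lemma nk3 : 3 * k <= n. Proof. by nia. Qed.

(** Giving up [2 * k - 2] points costs at most as many terms ['C(n - 2, k - 1)], together at most
    3/4 of ['C(n.-1, k)] by [nk]. *)
Lemma common_nbr_bound : 'C(n.-1, k) < 5 * 'C(n - (2 * k).-1, k).
Proof.
have := @bin_le_drop n.-1 (2 * k - 2) k.-1; have := mul_bin_diag n.-1 k.-1.
rewrite prednK; last lia.
have -> : n.-1 - (2 * k - 2) = n - (2 * k).-1 by lia.
have : 0 < 'C(n - (2 * k).-1, k) by rewrite bin_gt0; nia.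
move: 'C(_, _) 'C(_, _) 'C(_, _) => Z Y X X0 YZ h.
have {}h : Z <= X + (2 * k - 2) * Y by apply: h; nia.
have : 4 * ((2 * k - 2) * Y) <= 3 * Z by nia.
lia.
Qed.

(** Here [k] points are given up, at a cost of at most 3/8 of ['C(n.-1, k.-1)]. *)
Lemma star_bound : 5 * 'C(n.-1, k.-1) <= 8 * 'C(n - k.+1, k.-1).
Proof.
have := @bin_le_drop n.-1 k k.-2; have := mul_bin_diag n.-1 k.-2.
have -> : n.-1 - k = n - k.+1 by lia.
rewrite prednK; last lia.
move: 'C(_, _) 'C(_, _) 'C(_, _) => X Z Y YZ h.
have {}h : Z <= X + k * Y by apply: h; nia.
have : 8 * (k * Y) <= 3 * Z by nia.
lia.
Qed.

(** The left side is at most [6 ^ k.-1 * 'C((2 * k).-1, k.-1)], because ['C(2 * k, k)] is twice that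
    binomial. The factor is [5 * (5 * k + 1)], as needed at the end of [edge_components_strict]. *)
Lemma bollobas_bound : (25 * k + 5) * 'C(k + k, k) < 'C(n.-1, k.-1).
Proof.
have p6 : 6 * (2 * k).-1 <= n.-1 by nia.
apply: leq_trans (bin_ge_expn k.-1 _ p6) => //.
have := mul_bin_diag (2 * k) k.-1; rewrite prednK; last lia.
have -> : k + k = 2 * k by lia.
have := expn6_gt k5; have : 0 < 'C((2 * k).-1, k.-1) by rewrite bin_gt0; lia.
move: (6 ^ _) 'C(_, _) 'C(_, _) => a c b b0 ha hb; have -> : c = 2 * b by nia.
nia.
Qed.
End Bounds.

(** * Components of a vertex-deleted graph *)

Section Components.
Variables (T : finType) (adj : rel T) (S : {set T}).
Hypothesis adj_sym : symmetric adj.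

Definition isolated : {set T} := [set x in ~: S | [forall y in ~: S, ~~ adj x y]].
Definition edge_components : {set {set T}} :=
  [set C in components adj S | [exists x in C, exists y in C, adj x y]].

Let comp x := [set y | connect (del_adj adj S) x y].

Lemma del_sym : connect_sym (del_adj adj S).
Proof. by apply: sym_connect_sym => x y; rewrite /del_adj adj_sym andbCA. Qed.

Lemma connect_notin x y : x \notin S -> connect (del_adj adj S) x y -> y \notin S.
Proof.
move=> xS /connectP[p pp ->]; elim: p x xS pp => [//|z p IH] x xS /= /andP[/and3P[_ zS _]].
exact: IH.
Qed.

Lemma component_notin C x : C \in components adj S -> x \in C -> x \notin S.
Proof. by case/imsetP=> z; rewrite inE => zS ->; rewrite inE => /(connect_notin zS). Qed.

Lemma componentE C x : C \in components adj S -> x \in C -> C = comp x.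
Proof.
case/imsetP=> z zS ->; rewrite inE => zx; apply/setP=> y; rewrite !inE.
exact: (same_connect del_sym zx).
Qed.

Lemma component_mem x : x \notin S -> comp x \in components adj S.
Proof. by move=> xS; apply/imsetP; exists x; rewrite ?inE. Qed.

Lemma comp_adj x y : x \notin S -> y \notin S -> adj x y -> comp x = comp y.
Proof.
move=> xS yS xy; apply: componentE; first exact: component_mem.
by rewrite inE connect1 // /del_adj xS yS.
Qed.

Lemma components_nonadj C C' x y : C \in components adj S -> C' \in components adj S ->
  C != C' -> x \in C -> y \in C' -> ~~ adj x y.
Proof.
move=> CS CS' CC xC yC; apply: contraNN CC => xy; apply/eqP.
rewrite (componentE CS xC) (componentE CS' yC).
by apply: comp_adj xy; [exact: component_notin CS xC|exact: component_notin CS' yC].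
Qed.

Lemma comp_isolated x : x \in isolated -> comp x = [set x].
Proof.
rewrite inE => /andP[xS /forall_inP xi]; apply/setP=> y; rewrite !inE.
apply/idP/eqP => [/connectP[[|z p] //= /andP[/and3P[_ zS xz] _]]|->//].
by have := xi z; rewrite inE zS xz => /(_ isT).
Qed.

(** A component without an edge is the singleton of an isolated vertex. *)
Lemma ncomp_le : ncomp adj S <= #|isolated| + #|edge_components|.
Proof.
rewrite /ncomp -(cardsID edge_components (components adj S)) addnC leq_add //; last first.
  by apply/subset_leq_card/subsetIr.
rewrite -(card_imset isolated set1_inj); apply/subset_leq_card/subsetP => C.
rewrite !inE => /andP[nJ CS]; move: nJ; rewrite CS /= => /exists_inPn nJ.
case/imsetP: (CS) => x; rewrite inE => xS CE.
have xC : x \in C by rewrite CE inE connect0.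
have xi : x \in isolated.
  rewrite !inE xS; apply/forall_inP => y; rewrite inE => yS; apply: contraT => /negPn xy.
  have := nJ x xC; rewrite negb_exists_in => /forall_inP/(_ y); rewrite xy; apply.
  by rewrite (componentE CS xC) inE connect1 // /del_adj xS yS.
by rewrite CE [X in X \in _](comp_isolated xi) imset_f.
Qed.

Lemma isolatedE : edge_components = set0 -> isolated = ~: S.
Proof.
move=> J0; apply/setP=> x; rewrite inE; case xS: (x \in ~: S) => //=.
apply/forall_inP=> y yS; apply: contraT => /negPn xy.
move: xS yS; rewrite !inE => xS yS.
suff : comp x \in edge_components by rewrite J0 inE.
rewrite inE component_mem //=; apply/exists_inP; exists x; first by rewrite inE connect0.
by apply/exists_inP; exists y => //; rewrite (comp_adj xS yS xy) inE connect0.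
Qed.

Lemma ncomp_independent : independent adj (~: S) -> ncomp adj S = #|~: S|.
Proof.
move=> /forall_inP ind; rewrite /ncomp /components -(card_imset (~: S) set1_inj).
congr #|pred_of_set _|; apply: eq_in_imset => x xS; apply: comp_isolated.
by rewrite inE xS; apply: ind.
Qed.

Lemma cut_nonadj : is_vertex_cut adj S -> exists x y, [/\ x \notin S, y \notin S & comp x != comp y].
Proof.
case/card_gt1P=> C [C' [/imsetP[x xS CE] /imsetP[y yS CE'] CC]].
by exists x, y; move: xS yS; rewrite !inE => xS yS; split=> //; rewrite /comp -CE -CE'.
Qed.

Lemma common_nbr x y z : x \notin S -> y \notin S -> comp x != comp y ->
  adj x z -> adj y z -> z \in S.
Proof.
move=> xS yS xy xz yz; apply: contraNT xy => zS.
by rewrite (comp_adj xS zS xz) (comp_adj yS zS yz).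
Qed.

End Components.

(** Deleting [y] from the members of [F] gives [k - 1]-sets that meet [B]; those avoiding both [y]
    and [B] are a disjoint collection, and both avoid [y]. Hence a point of large degree in [I] must
    lie in every vertex of [U]. *)
Lemma card_star_meet n k (F : {set {set 'I_n}}) (y : 'I_n) (B : {set 'I_n}) :
  0 < k -> #|B| = k -> y \notin B -> {in F, forall A : {set 'I_n}, #|A| = k} ->
  {in F, forall A : {set 'I_n}, y \in A /\ ~~ [disjoint A & B]} ->
  #|F| + 'C(n - k.+1, k.-1) <= 'C(n.-1, k.-1).
Proof.
move=> k0 Bk yB Fk FB.
pose sub (D : {set 'I_n}) := [set R : {set 'I_n} | (R \subset ~: (y |: D)) && (#|R| == k.-1)].
have csub (D : {set 'I_n}) : y \notin D -> #|sub D| = 'C(n - #|D|.+1, k.-1).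
  by move=> yD; rewrite cards_draws (cardsCs (~: _)) setCK card_ord cardsU1 yD.
have F1 : #|[set A :\ y | A : {set 'I_n} in F]| = #|F|.
  apply: card_in_imset => A A' /FB[yA _] /FB[yA' _] e.
  by rewrite -(setD1K yA) e setD1K.
have -> : 'C(n.-1, k.-1) = #|sub set0| by rewrite csub ?inE // cards0 subn1.
have -> : 'C(n - k.+1, k.-1) = #|sub B| by rewrite csub // Bk.
rewrite -{1}F1 -cardsUI [X in _ + X](_ : _ = 0) ?addn0; last first.
  apply/eqP; rewrite cards_eq0; apply/eqP/setP=> R; rewrite in_set0 inE; apply/negP.
  case/andP=> /imsetP[A AF ->]; rewrite inE => /andP[/subsetP RB _].
  case: (FB _ AF) => yA /negP; apply; apply/pred0P=> z /=; apply/negP=> /andP[zA zB].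
  have zy : z != y by apply: contraNneq yB => <-.
  by have := RB z; rewrite !inE zy zA zB orbT => /(_ isT).
apply/subset_leq_card/subsetP=> R; rewrite inE => /orP[/imsetP[A AF ->]|].
  case: (FB _ AF) => yA _; rewrite inE; apply/andP; split.
    by apply/subsetP=> z; rewrite !inE orbF => /andP[].
  by have := cardsD1 y A; rewrite yA (Fk A AF) => /(congr1 predn) ->.
by rewrite !inE => /andP[RB ->]; rewrite andbT; apply: subset_trans RB _;
  rewrite setCS setU0 subsetUl.
Qed.

(** * Vertex cuts of the Kneser graph *)

Section Kneser.
Variables n k : nat.
Hypotheses (k5 : 5 <= k) (nk : 8 * k ^ 2 + 4 <= 3 * n + 6 * k).

Let T := kvert n k.
Let adj := kneser_adj n k.
Let k0 : 0 < k. Proof. lia. Qed.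
Let kn : 3 * k <= n := nk3 k5 nk.

Let adj_sym : symmetric adj.
Proof. by move=> A B; rewrite /adj /kneser_adj disjoint_sym. Qed.

Let fam (F : {set T}) : {set {set 'I_n}} := [set val A | A in F].

Lemma card_fam F : #|fam F| = #|F|.
Proof. by rewrite card_imset //; apply: val_inj. Qed.

Lemma fam_card F : {in fam F, forall A : {set 'I_n}, #|A| = k}.
Proof. by move=> _ /imsetP[A _ ->]; apply/eqP/(valP A). Qed.

Lemma card_kvert : #|{: T}| = 'C(n, k).
Proof.
rewrite card_sig -[n in RHS]card_ord -card_draws.
by apply: eq_card => A; rewrite !inE.
Qed.

Lemma nonadj_ratio (I U : {set T}) : I \subset U ->
  (forall A B, A \in I -> B \in U -> ~~ adj A B) ->
  k * #|U| + (n - k) * #|I| <= k * 'C(n, k).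
Proof.
move=> IU nadj; rewrite -(card_fam I) -(card_fam U); apply: cross_ratio => //.
- exact: imsetS.
- exact: fam_card.
- by move=> _ _ /imsetP[A AI ->] /imsetP[B BU ->]; apply: nadj.
Qed.

Lemma independent_bound (I : {set T}) : independent adj I -> n * #|I| <= k * 'C(n, k).
Proof.
move=> /forall_inP ind; have -> : n * #|I| = k * #|I| + (n - k) * #|I|.
  by rewrite -mulnDl subnKC //; lia.
by apply: nonadj_ratio => // A B /ind/forall_inP; apply.
Qed.

Lemma max_independent_eq (I : {set T}) : independent adj I ->
  n * #|I| = k * 'C(n, k) -> max_independent adj I.
Proof.
move=> indI cI; rewrite /max_independent indI; apply/forallP=> J; apply/implyP=> indJ.
by rewrite -(leq_pmul2l (_ : 0 < n)) ?cI ?independent_bound //; lia.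
Qed.

(** One edge is picked in each component: its ends are disjoint, while vertices of different
    components are nonadjacent and so intersect. This is a Bollobas system. *)
Lemma edge_components_le (S : {set T}) : #|edge_components adj S| <= 'C(k + k, k).
Proof.
pose e (C : {set T}) := [pick p : T * T | [&& p.1 \in C, p.2 \in C & adj p.1 p.2]].
pose Af C := if e C is Some p then val p.1 else set0.
pose Bf C := if e C is Some p then val p.2 else set0.
have eP C : C \in edge_components adj S -> exists x y,
    [/\ C \in components adj S, x \in C, y \in C, adj x y & Af C = val x /\ Bf C = val y].
  rewrite inE => /andP[CS /exists_inP[x xC /exists_inP[y yC xy]]].
  rewrite /Af /Bf /e; case: pickP => [[x' y'] /= /and3P[? ? ?]|/(_ (x, y))]; last first.
    by rewrite /= xC yC xy.
  by exists x', y'.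
apply: (@bollobas _ _ Af Bf).
- move=> C /eP[x [y [_ _ _ xy [-> ->]]]].
  by split=> //; apply/eqP; [apply: (valP x)|apply: (valP y)].
- move=> C C' /eP[x [_ [CS xC _ _ [-> _]]]] /eP[_ [y [CS' _ yC' _ [_ ->]]]] CC.
  exact: (components_nonadj adj_sym CS CS' CC xC yC').
Qed.

(** Vertices in different components intersect, so they cover at most [2 * k - 1] points; every
    [k]-set avoiding both is a common neighbour and must lie in [S]. *)
Lemma cut_card (S : {set T}) : is_vertex_cut adj S -> 'C(n - (2 * k).-1, k) <= #|S|.
Proof.
case/cut_nonadj=> x [y [xS yS xy]].
have nxy : ~~ adj x y by apply: contraNN xy => h; rewrite (comp_adj adj_sym xS yS h).
have cU : #|val x :|: val y| <= (2 * k).-1.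
  move: nxy; rewrite /adj /kneser_adj -setI_eq0 -cards_eq0 cardsU.
  by rewrite (eqP (valP x)) (eqP (valP y));
    move: #|_ :&: _| => m; lia.
apply: leq_trans (_ : 'C(#|~: (val x :|: val y)|, k) <= _).
  by apply: leq_bin2l; rewrite cardsCs setCK card_ord leq_sub2l.
rewrite -cards_draws -(card_fam S); apply/subset_leq_card/subsetP=> A.
rewrite inE => /andP[Axy cA]; apply/imsetP; exists (exist _ A cA) => //.
move: Axy; rewrite setCU subsetI !subsets_disjoint !setCK => /andP[Ax Ay].
by apply: (common_nbr adj_sym xS yS xy); rewrite /adj /kneser_adj disjoint_sym.
Qed.

Lemma edge_components_strict (S : {set T}) : is_vertex_cut adj S ->
  edge_components adj S != set0 -> (n - k) * ncomp adj S < k * #|S|.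
Proof.
move=> cutS J0; have n0 : 0 < n by lia.
pose al := 'C(n.-1, k.-1); pose c := ncomp adj S.
have alE : (n - k) * al = k * 'C(n.-1, k).
  have := mul_bin_left n.-1 k.-1; rewrite prednK // => ->.
  by congr (_ * _); lia.
(* The threshold 5 is the factor in [common_nbr_bound]: if [5 * c <= al], then [(n - k) * (5 * c) <=
   k * 'C(n.-1, k) < 5 * k * #|S|]. *)
have [small|large] := leqP (5 * c) al.
  have h1 := common_nbr_bound k5 nk; have h2 := cut_card cutS.
  rewrite -/c -(ltn_pmul2l (isT : 0 < 5)).
  have h3 : (n - k) * (5 * c) <= k * 'C(n.-1, k) by rewrite -alE leq_mul2l small orbT.
  by rewrite mulnCA; apply: leq_ltn_trans h3 _; rewrite mulnCA ltn_pmul2l //; lia.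
rewrite ltnNge; apply/negP => le.
pose I := isolated adj S; pose b := #|edge_components adj S|.
have cab : c <= #|I| + b by apply: ncomp_le.
have bC : b <= 'C(k + k, k) by apply: edge_components_le.
have IU : forall A B, A \in fam I -> B \in fam (~: S) -> ~~ [disjoint A & B].
  move=> _ _ /imsetP[A + ->] /imsetP[B BU ->]; rewrite inE => /andP[_ /forall_inP]; exact.
have sIU : fam I \subset fam (~: S) by apply/imsetS/subsetP => x; rewrite inE => /andP[].
pose C := 'C(n - k.+1, k.-1).
have aC : 5 * al <= 8 * C by apply: star_bound.
have Cal : C <= al by apply: leq_bin2l; lia.
(* A degree above [al - C] contradicts [card_star_meet] for any vertex of [U] that misses [y]. *)
have [starlike|/existsPn deg] := boolP [exists y, al - C < #|[set A in fam I | y \in A]|].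
  have [y ydeg] := existsP starlike.
  have Uy B : B \in ~: S -> y \in val B.
    move=> BU; apply: contraT => yB.
    have := @card_star_meet n k [set A in fam I | y \in A] y (val B) k0 (eqP (valP B)) yB.
    suff : [set A in fam I | y \in A] \subset fam I.
      move=> /subsetP sub h; have : #|[set A in fam I | y \in A]| + C <= al.
        apply: h => A; first by move/sub/fam_card.
        by rewrite inE => /andP[AI yA]; split=> //; apply: IU => //; apply: imset_f.
      by rewrite -/al; lia.
    by apply/subsetP=> A; rewrite inE => /andP[].
  case/set0Pn: J0 => D; rewrite inE => /andP[DS /exists_inP[x xD /exists_inP[z zD]]].
  move=> /pred0P/(_ y) /=; have inU w : w \in D -> w \in ~: S.
    by move=> wD; rewrite inE; apply: component_notin DS wD.
  by rewrite !Uy ?inU.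
have deg' y : #|[set A in fam I | y \in A]| <= al - C.
  by rewrite leqNgt; apply: (deg y).
have := cross_stability k0 kn sIU (@fam_card _) IU deg'.
rewrite -/C !card_fam.
have : #|S| + #|~: S| = 'C(n, k) by rewrite cardsC card_kvert.
have nk2 : n - k <= 2 * (n - 2 * k) by lia.
have nk0 : 0 < n - 2 * k by lia.
have C0 : 0 < C by rewrite bin_gt0; lia.
have := bollobas_bound k5 nk; rewrite -/al.
move: le cab large bC aC Cal nk2 nk0 C0; rewrite -/c.
clearbody c al C b; move: #|I| #|S| #|~: S| 'C(n, k) 'C(k + k, k) => a s u N X.
move: (n - k) (n - 2 * k) => p q le cab large bC aC Cal pq q0 C0 bol suN stab.
(* Since [s + u = N], the deficit is [k * s - p * a], and the assumed failure gives
   [k * s <= p * c <= p * (a + b)]. *)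
have dl : k * N - (k * u + p * a) <= p * b by nia.
have st2 : (2 * C) * a * q <= 5 * k * C * (2 * q * b).
  have h1 : 2 * C <= 5 * (C - (al - C)) by lia.
  have h2 : k * C * (k * N - (k * u + p * a)) <= k * C * (2 * q * b).
    by rewrite leq_mul2l; apply/orP; right; apply: leq_trans dl _; rewrite leq_mul2r pq orbT.
  have h3 := leq_trans stab h2.
  apply: leq_trans (_ : 5 * (C - (al - C)) * a * q <= _); first by rewrite !leq_mul2r h1 !orbT.
  by move: (C - _) h3 => Y h3; nia.
have a5 : a <= 5 * k * b.
  have Cq : 0 < 2 * C * q by rewrite !muln_gt0 C0 q0.
  by rewrite -(leq_pmul2l Cq); nia.
(* Contradiction: [al < 5 * c <= 5 * (a + b) <= (25 * k + 5) * b <= (25 * k + 5) * X < al]. *)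
nia.
Qed.

(** With no edge component, [~: S] is independent and its vertices are the components, so the claim
    is the Erdos-Ko-Rado bound rearranged. Otherwise the inequality is strict. *)
Lemma cut_bound (S : {set T}) : is_vertex_cut adj S ->
  (n - k) * ncomp adj S <= k * #|S| /\
  ((n - k) * ncomp adj S = k * #|S| -> max_independent adj (~: S)).
Proof.
move=> cutS; have [J0|/(edge_components_strict cutS) lt] := eqVneq (edge_components adj S) set0.
  have IE := isolatedE adj_sym J0.
  have ind : independent adj (~: S).
    by apply/forall_inP=> x; rewrite -{1}IE inE => /andP[].
  have cE := ncomp_independent ind.
  have sE : #|S| + #|~: S| = 'C(n, k) by rewrite cardsC card_kvert.
  have := independent_bound ind; rewrite cE -sE => le; split; first by rewrite mulnBl leq_subLR addnC -mulnDr.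
  move=> eq; apply: max_independent_eq => //; rewrite -sE mulnDr -eq -mulnDl subnK //; lia.
by split; [exact: ltnW|move=> eq; rewrite eq ltnn in lt].
Qed.

Lemma star_cut : exists S : {set T}, is_vertex_cut adj S /\ (n - k) * ncomp adj S = k * #|S|.
Proof.
have n0 : 0 < n by lia.
pose x := Ordinal n0; pose I := [set A : T | x \in val A].
have ind : independent adj I.
  apply/forall_inP=> A; rewrite inE => xA; apply/forall_inP=> B; rewrite inE => xB.
  by apply/negP=> /pred0P/(_ x); rewrite /= xA xB.
have cS : #|~: I| = 'C(n.-1, k).
  have <- : #|~: [set x]| = n.-1 by rewrite cardsCs setCK cards1 card_ord subn1.
  rewrite -cards_draws -(card_fam (~: I)); apply: eq_card => A.
  apply/imsetP/idP => [[B + ->]|]; rewrite !inE.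
    by move=> xB; rewrite (valP B) andbT subsetC sub1set inE.
  rewrite subsetC sub1set inE => /andP[xA cA].
  by exists (exist _ A cA); rewrite ?inE.
have cI : #|I| = 'C(n.-1, k.-1).
  have := cardsC I; rewrite card_kvert cS; have := binS n.-1 k.-1.
  by rewrite !prednK //; lia.
exists (~: I); have ncI : ncomp adj (~: I) = #|I| by rewrite ncomp_independent setCK.
rewrite /is_vertex_cut ncI cI cS; split.
  (* At least two components: ['C(n.-1, k.-1) >= 'C(k, k.-1) = k]. *)
  have -> : n.-1 = (n - 3).+2 by lia.
  have -> : k.-1 = (k - 3).+2 by lia.
  apply: leq_trans (_ : 'C((k - 3).+3, (k - 3).+2) <= _); first by rewrite binSn.
  by apply: leq_bin2l; lia.
have := mul_bin_left n.-1 k.-1; rewrite prednK // => ->.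
by congr (_ * _); lia.
Qed.

End Kneser.

(* Passage to real numbers and the toughness *)
From mathcomp Require Import all_classical all_reals all_analysis.
Import Order.TTheory GRing.Theory Num.Theory.
Local Open Scope ring_scope.

(* (1 + 3/32)^8 > 2. *)
Lemma ln2_le (R : realType) : ln (2 : R) <= 3 / 4.
Proof.
rewrite -[X in _ <= X]expRK ler_ln ?posrE ?expR_gt0 //.
have -> : 3 / 4 = 8%:R * (3 / 32) :> R by field.
rewrite expRM_natl; apply: le_trans (_ : (1 + 3 / 32) ^+ 8 <= _); first lra.
by rewrite lerXn2r ?nnegrE ?expR_ge0 ?expR_ge1Dx //; lra.
Qed.

(* The hypothesis reads n >= (2k - 1)(k - 1) / ln 2 + 2k. *)
Lemma quadratic_bound (R : realType) (n k : nat) :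
  (5 <= k)%N ->
  2 / ln (2 : R) * (k%:R) ^+ 2 + (2 - 3 / ln 2) * k%:R + 1 / ln 2 <= n%:R ->
  (8 * k ^ 2 + 4 <= 3 * n + 6 * k)%N.
Proof.
move=> k5 h; have L0 : 0 < ln (2 : R) by rewrite ln_gt0 ?ltr1n.
have i43 : 4 / 3 <= (ln (2 : R))^-1.
  have -> : 4 / 3 = (3 / 4)^-1 :> R by field.
  by rewrite lef_pV2 ?posrE ?ln2_le //; lra.
rewrite -(ler_nat R) !natrD !natrM.
have k5' : 5 <= k%:R :> R by rewrite ler_nat.
move: h i43; move: (ln 2)^-1 (k%:R : R) k5' (n%:R : R) => i x x5 y h i43.
have q0 : 0 <= 2 * x ^+ 2 - 3 * x + 1 by nra.
nra.
Qed.

Theorem theorem1p3 (R : realType) (n k : nat) :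
  (5 <= k)%N ->
  2 / ln (2 : R) * (k%:R) ^+ 2 + (2 - 3 / ln 2) * k%:R + 1 / ln 2 <= n%:R ->
  is_toughness (kneser_adj n k) (n%:R / k%:R - 1 : R) /\
  (forall S : {set kvert n k},
      is_vertex_cut (kneser_adj n k) S ->
      tough_ratio (kneser_adj n k) R S = n%:R / k%:R - 1 ->
      exists I : {set kvert n k},
        max_independent (kneser_adj n k) I /\ S = ~: I).
Proof.
move=> k5 /(quadratic_bound k5) nk.
have kR : 0 < k%:R :> R by rewrite ltr0n; lia.
(* In the form [(n - k) / k], comparison with a toughness ratio becomes the integer comparison of
   [cut_bound]. *)
have tE : n%:R / k%:R - 1 = (n - k)%N%:R / k%:R :> R.
  by rewrite natrB; [rewrite mulrBl divff ?gt_eqF|have := nk3 k5 nk; lia].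
have cR S : is_vertex_cut (kneser_adj n k) S -> 0 < (ncomp (kneser_adj n k) S)%:R :> R.
  by rewrite ltr0n => /ltnW.
have kN0 : k%:R != 0 :> R by rewrite gt_eqF.
have cN0 S : is_vertex_cut (kneser_adj n k) S -> (ncomp (kneser_adj n k) S)%:R != 0 :> R.
  by move=> cutS; rewrite gt_eqF ?cR.
split; first split.
- have [S [cutS SE]] := star_cut k5 nk; exists S; split=> //.
  apply/eqP; rewrite /tough_ratio tE eqr_div ?cN0 // -!natrM.
  by rewrite mulnC SE mulnC.
- move=> S cutS; have [le _] := cut_bound k5 nk cutS.
  by rewrite /tough_ratio tE ler_pdivrMr // mulrAC ler_pdivlMr ?cR // -!natrM ler_nat (mulnC #|S|).
- move=> S cutS eq; exists (~: S); split; last by rewrite finset.setCK.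
  have [_] := cut_bound k5 nk cutS; apply.
  move/eqP: eq; rewrite /tough_ratio tE eqr_div ?cN0 // -!natrM eqr_nat.
  by move/eqP => <-; rewrite mulnC.
Qed.
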